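(* Let $\gamma$ be a curve in $\mathbb{R}^2$ (identified with the $xz$-plane) with non-constant curvature, parametrized by arc length $s$, with curvature $\theta'(s)$. 1. Let $p,\mu\in\mathbb{R}$, $p\neq 0,1$. If $\gamma$ is a critical curve of $\mathcal{F}^{\mu *}_p(\gamma)=\int_0^L(\theta'(s)-\mu)^p\,ds$, then, up to rigid motions, $\gamma$ can be parametrized as $$\gamma(s)=d\left(p\left(\theta'-\mu\right)^{p-1},\,0,\,\int\left(\theta'-\mu\right)^{p-1}\left((p-1)\theta'+\mu\right)ds\right)$$ for some constant $d>0$. 2. Let $\nu\in\mathbb{R}$, $\nu\neq 0$. If $\gamma$ is a critical curve of $\mathcal{F}_\nu(\gamma)=\int_0^L e^{\nu\theta'(s)}\,ds$, then, up to rigid motions, $\gamma$ can be parametrized as $$\gamma(s)=d\left(\nu e^{\nu\theta'},\,0,\,\int\left(\nu\theta'-1\right)e^{\nu\theta'}ds\right)$$ for some constant $d>0$. Moreover, in both cases, the rotational surface generated by rotating the critical curve $\gamma$ (in the position given by $\gamma(s)=d\left(p(\theta'-\mu)^{p-1},\,0,\,\int(\theta'-\mu)^{p-1}((p-1)\theta'+\mu)\,ds\right)$ if the functional is $\mathcal{F}^{\mu *}_p$, and by $\gamma(s)=d\left(\nu e^{\nu\theta'},\,0,\,\int(\nu\theta'-1)e^{\nu\theta'}ds\right)$ if the functional is $\mathcal{F}_\nu$) around the $z$-axis satisfies the Weingarten relation $\kappa_1=a\kappa_2+b$, where $$a=\frac{p}{p-1},\quad b=\frac{-\mu}{p-1}$$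 if the functional is $\mathcal{F}^{\mu *}_p$, and $$a=1,\quad b=\frac1\nu$$ if the functional is $\mathcal{F}_\nu$.
   Context: For a regular plane curve, $s$ is arc length, $L$ the length, and writing $\gamma(s)=(x(s),0,z(s))$ with $x'=\cos\theta$, $z'=\sin\theta$, the curvature is $\theta'(s)$. Let $\Omega_{p_0p_1}$ be the space of smooth regular plane curves joining two fixed points $p_0,p_1$, and $\Omega^*_{p_0p_1}$ the subspace of those curves whose curvature is greater than $\mu$. The functional $\mathcal{F}^{\mu *}_p$ acts on $\Omega^*_{p_0p_1}$ and $\mathcal{F}_\nu$ acts on $\Omega_{p_0p_1}$. A curve is critical (extremal) for such a functional if it satisfies its Euler-Lagrange equation, that is, the first variation of the functional at the curve vanishes for every smooth variation whose variation field is compactly supported in the interior of the parameter interval. For the surface of revolution $X(s,\phi)=(x(s)\cos\phi,x(s)\sin\phi,z(s))$ generated by an arc-length parametrized curve $\gamma(s)=(x(s),0,z(s))$ with $x'=\cos\theta$, $z'=\sin\theta$, the principal curvatures are $\kappa_1=\theta'$ (the curvature of the profile curve) and $\kappa_2=\sin\theta/x$. *)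

(* Defs.v *)
From Stdlib Require Export Reals Lra.
From Coquelicot Require Export Coquelicot.
Open Scope R_scope.

(* A plane curve with parameter interval [0, L] is a pair of total functions
   x, z : R -> R, of which only the restrictions to [0, L] matter.  A function
   is smooth on the closed interval iff it has a smooth extension to R, so
   smoothness is asked on all of R; the two-sided derivatives at 0 and L then
   coincide with the one-sided ones. *)
Definition smooth (f : R -> R) : Prop :=
  forall (n : nat) (s : R), ex_derive_n f n s.

Definition smooth2 (f : R -> R -> R) : Prop :=
  forall (n : nat) (t s : R), ex_diff_n f n t s.

Definition speed (x z : R -> R) (u : R) : R :=
  sqrt (Derive x u ^ 2 + Derive z u ^ 2).

Definition curvature (x z : R -> R) (u : R) : R :=
  (Derive x u * Derive_n z 2 u - Derive_n x 2 u * Derive z u)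
  / speed x z u ^ 3.

(* Parametrizations are arbitrary (not unit speed) in these two spaces. *)
Definition Omega (L : R) (p0 p1 : R * R) (x z : R -> R) : Prop :=
  smooth x /\ smooth z /\
  (forall u, 0 <= u <= L -> 0 < speed x z u) /\
  (x 0, z 0) = p0 /\ (x L, z L) = p1.

Definition Omega_star (mu L : R) (p0 p1 : R * R) (x z : R -> R) : Prop :=
  Omega L p0 p1 x z /\ (forall u, 0 <= u <= L -> mu < curvature x z u).

(* The integral of P(curvature) with respect to arc length, in an arbitrary
   regular parametrization. *)
Definition curvature_functional (P : R -> R) (L : R) (x z : R -> R) : R :=
  RInt (fun u => P (curvature x z u) * speed x z u) 0 L.

(* On Omega_star the base of [Rpower] is positive, as [Rpower] requires. *)
Definition F_star (p mu L : R) : (R -> R) -> (R -> R) -> R :=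
  curvature_functional (fun k => Rpower (k - mu) p) L.

Definition F_exp (nu L : R) : (R -> R) -> (R -> R) -> R :=
  curvature_functional (fun k => exp (nu * k)) L.

(* t |-> (X t, Z t) is a smooth variation of (x, z) within Space (for t near 0),
   whose variation field is compactly supported in the open interval (0, L). *)
Definition variation (Space : (R -> R) -> (R -> R) -> Prop) (L : R)
    (x z : R -> R) (X Z : R -> R -> R) : Prop :=
  smooth2 X /\ smooth2 Z /\
  (forall s, 0 <= s <= L -> X 0 s = x s /\ Z 0 s = z s) /\
  (exists eps, 0 < eps /\ forall t, Rabs t < eps -> Space (X t) (Z t)) /\
  (exists a b, 0 < a /\ b < L /\
     forall s, 0 <= s <= L -> s < a \/ b < s ->
       Derive (fun t => X t s) 0 = 0 /\ Derive (fun t => Z t s) 0 = 0).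

Definition critical (Space : (R -> R) -> (R -> R) -> Prop)
    (F : (R -> R) -> (R -> R) -> R) (L : R) (x z : R -> R) : Prop :=
  Space x z /\
  forall X Z : R -> R -> R, variation Space L x z X Z ->
    is_derive (fun t => F (X t) (Z t)) 0 0.

Definition arc_length_curve (L : R) (x z theta : R -> R) : Prop :=
  smooth x /\ smooth z /\ smooth theta /\
  forall s, 0 <= s <= L ->
    Derive x s = cos (theta s) /\ Derive z s = sin (theta s).

Definition nonconstant_curvature (L : R) (theta : R -> R) : Prop :=
  exists s1 s2, 0 <= s1 <= L /\ 0 <= s2 <= L /\
    Derive theta s1 <> Derive theta s2.

Lemma curvature_arc_length (L : R) (x z theta : R -> R) (s : R) :
  arc_length_curve L x z theta -> 0 < s < L ->
  curvature x z s = Derive theta s.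
Proof.
intros (Hx & Hz & Ht & H) Hs.
assert (Hd : ex_derive theta s) by exact (Ht 1%nat s).
assert (Hloc : locally s (fun u => 0 <= u <= L)).
{ apply (filter_imp (fun u => 0 < u /\ u < L)); [intros u; lra|].
  apply filter_and; [apply (open_gt 0)|apply (open_lt L)]; lra. }
assert (E1 : Derive_n x 2 s = - Derive theta s * sin (theta s)).
{ simpl. rewrite (Derive_ext_loc _ (fun u => cos (theta u))).
  - apply is_derive_unique. auto_derive; [exact Hd|]. change (Derive (fun v => theta v) s) with (Derive theta s). ring.
  - apply filter_imp with (2 := Hloc). intros u Hu. apply (H u Hu). }
assert (E2 : Derive_n z 2 s = Derive theta s * cos (theta s)).
{ simpl. rewrite (Derive_ext_loc _ (fun u => sin (theta u))).
  - apply is_derive_unique. auto_derive; [exact Hd|]. change (Derive (fun v => theta v) s) with (Derive theta s). ring.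
  - apply filter_imp with (2 := Hloc). intros u Hu. apply (H u Hu). }
destruct (H s) as [D1 D2]; [lra|].
pose proof (sin2_cos2 (theta s)) as T. unfold Rsqr in T.
unfold curvature, speed. rewrite E1, E2, D1, D2.
replace (cos (theta s) ^ 2 + sin (theta s) ^ 2) with 1 by (simpl; lra).
rewrite sqrt_1.
transitivity (Derive theta s *
  (sin (theta s) * sin (theta s) + cos (theta s) * cos (theta s))).
- field.
- rewrite T. ring.
Qed.

(* The orientation-preserving rigid motion of the plane: rotation by phi, then
   translation by (c1, c2).  It turns the angle function theta of an arc-length
   parametrized curve into theta + phi and leaves the curvature unchanged. *)
Definition move_x (phi c1 : R) (x z : R -> R) (s : R) : R :=
  cos phi * x s - sin phi * z s + c1.
Definition move_z (phi c2 : R) (x z : R -> R) (s : R) : R :=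
  sin phi * x s + cos phi * z s + c2.
Definition move_angle (phi : R) (theta : R -> R) (s : R) : R := theta s + phi.

(* (x, z) = d (f, ∫ g ds) on [0, L]; the constant of integration is arbitrary. *)
Definition in_position (L d : R) (f g x z : R -> R) : Prop :=
  (forall s, 0 <= s <= L -> x s = d * f s) /\
  (exists c, forall s, 0 <= s <= L -> z s = d * (RInt g 0 s + c)).

Definition kappa1 (theta : R -> R) (s : R) : R := Derive theta s.
Definition kappa2 (x theta : R -> R) (s : R) : R := sin (theta s) / x s.

Definition revolution_surface (x z : R -> R) (s phi : R) : R * R * R :=
  (x s * cos phi, x s * sin phi, z s).
Definition revolution_normal (theta : R -> R) (s phi : R) : R * R * R :=
  (- sin (theta s) * cos phi, - sin (theta s) * sin phi, cos (theta s)).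

Definition is_derive3 (f : R -> R * R * R) (t : R) (v : R * R * R) : Prop :=
  is_derive (fun u => fst (fst (f u))) t (fst (fst v)) /\
  is_derive (fun u => snd (fst (f u))) t (snd (fst v)) /\
  is_derive (fun u => snd (f u)) t (snd v).

Definition scal3 (k : R) (v : R * R * R) : R * R * R :=
  (k * fst (fst v), k * snd (fst v), k * snd v).

(* kappa1 and kappa2 are the principal curvatures of the surface of revolution,
   in the directions of the meridians and of the parallels: dN = - kappa dX
   along the coordinate lines. *)
Lemma revolution_principal_curvatures (x z theta : R -> R) (s phi : R) :
  is_derive x s (cos (theta s)) -> is_derive z s (sin (theta s)) ->
  ex_derive theta s -> x s <> 0 ->
  exists Xs Xphi : R * R * R,
    is_derive3 (fun u => revolution_surface x z u phi) s Xs /\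
    is_derive3 (fun v => revolution_surface x z s v) phi Xphi /\
    is_derive3 (fun u => revolution_normal theta u phi) s
      (scal3 (- kappa1 theta s) Xs) /\
    is_derive3 (fun v => revolution_normal theta s v) phi
      (scal3 (- kappa2 x theta s) Xphi).
Proof.
intros Hx Hz Ht H0.
exists (cos (theta s) * cos phi, cos (theta s) * sin phi, sin (theta s)).
exists (- x s * sin phi, x s * cos phi, 0).
assert (ex_derive x s) by (eexists; exact Hx).
assert (ex_derive z s) by (eexists; exact Hz).
pose proof (is_derive_unique _ _ _ Hx) as Ex.
pose proof (is_derive_unique _ _ _ Hz) as Ez.
change (Derive (fun u => x u) s = cos (theta s)) in Ex.
change (Derive (fun u => z u) s = sin (theta s)) in Ez.
unfold is_derive3, revolution_surface, revolution_normal, scal3, kappa1, kappa2.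
simpl.
split; [|split; [|split]]; (split; [|split]);
  auto_derive; auto;
  change (Derive (fun u => theta u) s) with (Derive theta s);
  try rewrite Ex; try rewrite Ez; try field; auto.
Qed.

(* The surface of revolution around the z-axis of the arc-length parametrized
   profile curve (x, z) with angle function theta has kappa1 = a kappa2 + b;
   x s <> 0 makes kappa2 meaningful. *)
Definition weingarten (L a b : R) (x theta : R -> R) : Prop :=
  forall s, 0 <= s <= L ->
    x s <> 0 /\ kappa1 theta s = a * kappa2 x theta s + b.

(* Up to rigid motions (x, z) has the position given by f and g, and in every
   such position its surface of revolution is Weingarten. *)
Definition position_and_weingarten (L a b : R) (f g x z theta : R -> R) : Prop :=
  (exists d phi c1 c2, 0 < d /\
     in_position L d f g (move_x phi c1 x z) (move_z phi c2 x z)) /\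
  (forall d phi c1 c2, 0 < d ->
     in_position L d f g (move_x phi c1 x z) (move_z phi c2 x z) ->
     weingarten L a b (move_x phi c1 x z) (move_angle phi theta)).

(* Main.v *)
Require Import Defs.
From Stdlib Require Import Arith Lia Classical.

(* For [int P(kappa) ds], varying only [x] or only [z] (translations are
   symmetries of the functional) and integrating by parts once shows that the
   vector [J = (kappa P' - P) T + (P'(kappa))_s N], with [T] the unit tangent
   and [N] the unit normal, is constant along a critical curve.  It is nonzero
   because the curvature is not constant and [P'' <> 0].  Rotate the curve so
   that [J] points along the z-axis and put [d = 1 / |J|]: the components of [J]
   along [N] and [T] become [x' = cos theta = d (P'(kappa))_s] and
   [z' = sin theta = d (kappa P' - P)].  Hence [x = d P'(kappa)] after a
   translation, and [sin theta / x = (kappa P' - P) / P'] is an affine function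
   of [kappa] for both choices of [P]. *)

(** * Smooth functions and bump functions *)

(** The two functionals enter only through an open set [D] of curvatures on which [P] is three times
    differentiable with [P''] nowhere zero, so one argument serves both. Test variations are affine
    in the parameter, [x + t phi] and [z + t psi], with [phi] and [psi] compactly supported. Such a
    family counts only if it stays in the space for small [t]: positive speed and curvature in [D]
    are open conditions at each point, and compactness of [[0, L]] makes the bound on [t] uniform;
    the same uniformity justifies differentiation under the integral. The constancy of [J] comes
    through the scalar equation [E = (P')_ss + kappa (kappa P' - P) = 0]: by the Frenet equations
    [J' = E N], and fields in the two coordinate directions give [E sin theta = 0] and
    [E cos theta = 0]. The equations of the curve hold only on [[0, L]], so they can be
    differentiated only in the open interval; the endpoints follow by continuity. *)

Lemma ex_derive_n_succ (f f' : R -> R) (n : nat) (s : R) :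
  (forall t, is_derive f t (f' t)) -> ex_derive_n f' n s ->
  ex_derive_n f (S n) s.
Proof.
intros Hf H.
destruct n as [|n].
- exists (f' s). apply Hf.
- apply ex_derive_ext with (2 := H). intros t.
  rewrite (Derive_n_ext f' (Derive_n f 1)).
  + rewrite Derive_n_comp. f_equal. lia.
  + intros u. symmetry. apply is_derive_unique, Hf.
Qed.

Lemma smooth_Derive (f : R -> R) : smooth f -> smooth (Derive f).
Proof.
intros Hf n s. destruct n as [|n]; [exact I|].
apply ex_derive_ext with (2 := Hf (S (S n)) s). intros t.
change (Derive f) with (Derive_n f 1).
rewrite Derive_n_comp. f_equal. lia.
Qed.

Lemma smooth_ex_derive (f : R -> R) (s : R) : smooth f -> ex_derive f s.
Proof. intros H. exact (H 1%nat s). Qed.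

Lemma smooth_is_derive (f : R -> R) (s : R) :
  smooth f -> is_derive f s (Derive f s).
Proof. intros H. apply Derive_correct, smooth_ex_derive, H. Qed.

Lemma smooth_continuous (f : R -> R) (s : R) : smooth f -> continuous f s.
Proof.
intros H. apply (ex_derive_continuous f s), smooth_ex_derive, H.
Qed.

Lemma smooth_plus (f g : R -> R) :
  smooth f -> smooth g -> smooth (fun s => f s + g s).
Proof.
intros Hf Hg n s.
apply ex_derive_n_plus; apply filter_forall; intros y k _; [apply Hf|apply Hg].
Qed.

Lemma smooth_scal (c : R) (f : R -> R) : smooth f -> smooth (fun s => c * f s).
Proof. intros Hf n s. apply ex_derive_n_scal_l, Hf. Qed.

Lemma smooth_const (c : R) : smooth (fun _ => c).
Proof.
intros n; revert c; induction n as [|n IH]; intros c s; [exact I|].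
apply ex_derive_n_succ with (fun _ => 0); [|apply IH].
intros t. auto_derive; auto.
Qed.

(** The Leibniz rule replaces the pair by [(f', g)] and [(f, g')], hence the induction over all
    pairs. It is a strong induction because differentiability of a sum at order [n] is deduced from
    that of its terms at every order up to [n]. *)
Lemma smooth_mult (f g : R -> R) :
  smooth f -> smooth g -> smooth (fun s => f s * g s).
Proof.
intros Hf Hg n; revert f g Hf Hg.
induction n as [n IH] using lt_wf_ind; intros f g Hf Hg s.
destruct n as [|n]; [exact I|].
apply ex_derive_n_succ with (fun s => Derive f s * g s + f s * Derive g s).
- intros t. apply (is_derive_mult f g).
  + apply smooth_is_derive, Hf.
  + apply smooth_is_derive, Hg.
  + apply Rmult_comm.
- apply ex_derive_n_plus; apply filter_forall; intros y k Hk;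
    apply IH; try lia; auto using smooth_Derive.
Qed.

Lemma smooth_comp_affine (f : R -> R) (a b : R) :
  smooth f -> smooth (fun s => f (a * s + b)).
Proof.
intros Hf n; revert f Hf; induction n as [|n IH]; intros f Hf s; [exact I|].
apply ex_derive_n_succ with (fun s => a * Derive f (a * s + b)).
- intros t. auto_derive.
  + apply smooth_ex_derive, Hf.
  + change (Derive (fun x => f x)) with (Derive f). ring.
- apply ex_derive_n_scal_l, IH, smooth_Derive, Hf.
Qed.

Lemma smooth2_affine (g h : R -> R) :
  smooth g -> smooth h -> smooth2 (fun t s => g s + t * h s).
Proof.
intros Hg Hh n t s.
(* The class of functions [g + t h] is closed under both partial derivatives, which give [h + t 0]
   and [g' + t h']. These hold only pointwise, so the induction runs over any [f] that agrees
   pointwise with such a function. *)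
enough (K : forall n g h (f : R -> R -> R), smooth g -> smooth h ->
  (forall t s, f t s = g s + t * h s) -> forall t s, ex_diff_n f n t s)
  by (apply (K n g h); auto).
clear. intros n. induction n as [|n IH]; intros g h f Hg Hh E t s.
- simpl. split; [|exact I].
  apply continuity_2d_pt_ext with (fun t s => g s + t * h s);
    [intros; symmetry; apply E|].
  apply continuity_2d_pt_plus; [|apply continuity_2d_pt_mult].
  + apply (continuity_1d_2d_pt_comp g (fun _ v => v)).
    * apply continuity_pt_filterlim, smooth_continuous, Hg.
    * apply continuity_2d_pt_id2.
  + apply continuity_2d_pt_id1.
  + apply (continuity_1d_2d_pt_comp h (fun _ v => v)).
    * apply continuity_pt_filterlim, smooth_continuous, Hh.
    * apply continuity_2d_pt_id2.
- assert (D1 : forall t s, is_derive (fun z => f z s) t (h s)).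
  { intros t' s'. apply is_derive_ext with (fun z => g s' + z * h s');
      [intros; symmetry; apply E|]. auto_derive; auto. ring. }
  assert (D2 : forall t s, is_derive (fun z => f t z) s
                             (Derive g s + t * Derive h s)).
  { intros t' s'. apply is_derive_ext with (fun z => g z + t' * h z);
      [intros; symmetry; apply E|]. auto_derive.
    - repeat split; apply smooth_ex_derive; auto.
    - change (Derive (fun x => g x)) with (Derive g).
      change (Derive (fun x => h x)) with (Derive h). ring. }
  split.
  { generalize (IH g h f Hg Hh E t s). destruct n; intros [H _]; exact H. }
  split; [eexists; apply D1|]. split; [eexists; apply D2|].
  split.
  + apply IH with h (fun _ => 0); [auto|apply smooth_const|].
    intros u v. transitivity (h v); [apply is_derive_unique, D1|ring].
  + apply IH with (Derive g) (Derive h); [apply smooth_Derive; auto..|].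
    intros u v. apply is_derive_unique, D2.
Qed.

(* [x^(-k) exp(-1/x)] for [x > 0], extended by zero.  The whole family is kept
   because its span is closed under differentiation. *)
Definition flat (k : nat) (x : R) : R :=
  match Rlt_dec 0 x with
  | left _ => (/ x) ^ k * exp (- / x)
  | right _ => 0
  end.

Lemma flat_pos (k : nat) (x : R) : 0 < x -> flat k x = (/ x) ^ k * exp (- / x).
Proof. intros H. unfold flat. destruct (Rlt_dec 0 x); [easy|contradiction]. Qed.

Lemma flat_nonpos (k : nat) (x : R) : x <= 0 -> flat k x = 0.
Proof. intros H. unfold flat. destruct (Rlt_dec 0 x); [lra|easy]. Qed.

(** The inequality [q <= exp q] at [q = y / n], raised to the power [n]. *)
Lemma pow_le_exp (n : nat) (y : R) : 0 <= y -> y ^ n <= INR n ^ n * exp y.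
Proof.
intros Hy. destruct n as [|n].
- simpl. rewrite Rmult_1_l. pose proof (exp_ineq1_le y). lra.
- assert (Hn : 0 < INR (S n)) by (apply lt_0_INR; lia).
  assert (Hq : 0 <= y / INR (S n)) by (apply Rdiv_le_0_compat; lra).
  replace (exp y) with (exp (y / INR (S n)) ^ S n).
  + rewrite <- Rpow_mult_distr. apply pow_incr. split; [exact Hy|].
    pose proof (exp_ineq1_le (y / INR (S n))).
    replace y with (INR (S n) * (y / INR (S n))) at 1 by (field; lra).
    apply Rmult_le_compat_l; lra.
  + rewrite <- Rpower_pow by apply exp_pos.
    unfold Rpower. rewrite ln_exp. f_equal. field. lra.
Qed.

(** Two powers of [x] are split off: [x^(-k) exp(-1/x) = x^2 x^(-k-2) exp(-1/x)], and the remaining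
    factor is bounded by [pow_le_exp] at [y = 1/x] with exponent [k + 2]. A quadratic bound is what
    makes the derivative at 0 vanish. *)
Lemma flat_quadratic (k : nat) :
  exists C, 0 < C /\ forall x, Rabs (flat k x) <= C * (x * x).
Proof.
exists (INR (k + 2) ^ (k + 2)). split.
{ apply pow_lt, lt_0_INR. lia. }
intros x. destruct (Rlt_le_dec 0 x) as [Hx|Hx].
- assert (Hi : 0 < / x) by now apply Rinv_0_lt_compat.
  rewrite flat_pos by exact Hx.
  rewrite Rabs_pos_eq
    by (apply Rmult_le_pos; [apply pow_le; lra|apply Rlt_le, exp_pos]).
  pose proof (pow_le_exp (k + 2) (/ x) (Rlt_le _ _ Hi)) as H.
  rewrite pow_add in H.
  replace ((/ x) ^ k) with ((/ x) ^ k * (/ x) ^ 2 * (x * x)) by (field; lra).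
  rewrite exp_Ropp.
  apply (Rmult_le_compat_r (x * x * / exp (/ x))) in H.
  + replace ((/ x) ^ k * (/ x) ^ 2 * (x * x) * / exp (/ x))
      with ((/ x) ^ k * (/ x) ^ 2 * (x * x * / exp (/ x))) by ring.
    eapply Rle_trans; [exact H|]. right. field.
    apply Rgt_not_eq, exp_pos.
  + apply Rmult_le_pos; [apply Rle_0_sqr|].
    apply Rlt_le, Rinv_0_lt_compat, exp_pos.
- rewrite flat_nonpos, Rabs_R0 by exact Hx.
  apply Rmult_le_pos; [|apply Rle_0_sqr].
  apply pow_le, pos_INR.
Qed.

Lemma is_derive_flat (k : nat) (x : R) :
  is_derive (flat k) x (flat (S (S k)) x + - INR k * flat (S k) x).
Proof.
destruct (total_order_T x 0) as [[Hx|Hx]|Hx].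
- rewrite !flat_nonpos by lra.
  apply is_derive_ext_loc with (fun _ => 0).
  + apply (filter_imp (fun u => u < 0)); [|now apply (open_lt 0)].
    intros u Hu. rewrite flat_nonpos; lra.
  + auto_derive; auto. ring.
- subst x. rewrite !flat_nonpos by lra.
  replace (0 + - INR k * 0) with 0 by ring.
  destruct (flat_quadratic k) as (C & HC & HB).
  apply is_derive_Reals. intros eps Heps.
  (* The difference quotient at 0 is at most [C |h|] in absolute value. *)
  assert (Hd : 0 < eps / C) by now apply Rdiv_lt_0_compat.
  exists (mkposreal _ Hd). simpl. intros h Hh Hlt.
  rewrite (flat_nonpos k 0), Rplus_0_l by lra.
  unfold Rminus. rewrite Ropp_0, !Rplus_0_r.
  unfold Rdiv. rewrite Rabs_mult, Rabs_inv.
  assert (Hp : 0 < Rabs h) by now apply Rabs_pos_lt.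
  apply Rmult_lt_reg_r with (Rabs h); [exact Hp|].
  rewrite Rmult_assoc, Rinv_l, Rmult_1_r by lra.
  eapply Rle_lt_trans; [apply HB|].
  replace (h * h) with (Rabs h * Rabs h).
  2:{ rewrite <- Rabs_mult. apply Rabs_pos_eq, Rle_0_sqr. }
  rewrite <- Rmult_assoc. apply Rmult_lt_compat_r; [exact Hp|].
  apply (Rmult_lt_compat_l C) in Hlt; [|exact HC].
  replace (C * (eps / C)) with eps in Hlt by (field; lra). exact Hlt.
- apply is_derive_ext_loc with (fun u => (/ u) ^ k * exp (- / u)).
  + apply (filter_imp (fun u => 0 < u)); [|now apply (open_gt 0)].
    intros u Hu. symmetry. now apply flat_pos.
  + rewrite !flat_pos by lra. auto_derive; [lra|].
    destruct k as [|k]; simpl pred; [simpl|rewrite <- !tech_pow_Rmult];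
    field; lra.
Qed.

Lemma smooth_flat (k : nat) : smooth (flat k).
Proof.
intros n; revert k. induction n as [n IH] using lt_wf_ind.
intros k s. destruct n as [|n]; [exact I|].
apply ex_derive_n_succ with (1 := is_derive_flat k).
apply ex_derive_n_plus; apply filter_forall; intros y j Hj;
  [|apply ex_derive_n_scal_l]; apply IH; lia.
Qed.

(** A product of two flat functions, of [s - a] and of [b - s]: each factor removes one side. *)
Lemma bump_exists (a b : R) :
  exists phi, smooth phi /\ (forall s, a < s < b -> 0 < phi s) /\
    (forall s, s <= a \/ b <= s -> phi s = 0).
Proof.
exists (fun s => flat 0 (1 * s + - a) * flat 0 (-1 * s + b)).
split; [|split].
- apply smooth_mult; apply smooth_comp_affine, smooth_flat.
- intros s Hs. rewrite !flat_pos by lra. simpl.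
  repeat apply Rmult_lt_0_compat; try apply exp_pos; lra.
- intros s [Hs|Hs].
  + rewrite (flat_nonpos 0 (1 * s + - a)) by lra. ring.
  + rewrite (flat_nonpos 0 (-1 * s + b)) by lra. ring.
Qed.

(** * Calculus lemmas *)

Lemma is_RInt_zero (f : R -> R) (a b : R) :
  (forall s, Rmin a b < s < Rmax a b -> f s = 0) -> is_RInt f a b 0.
Proof.
intros H. apply is_RInt_ext with (fun _ => 0).
- intros s Hs. symmetry. apply H, Hs.
- evar_last; [apply @is_RInt_const|].
  apply (scal_zero_r (V := R_NormedModule)).
Qed.

Lemma fundamental_lemma (f : R -> R) (L : R) :
  (forall s, 0 < s < L -> continuous f s) ->
  (forall phi a b, smooth phi -> 0 < a -> a < b -> b < L ->
    (forall s, s <= a \/ b <= s -> phi s = 0) ->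
    RInt (fun s => f s * phi s) 0 L = 0) ->
  forall s, 0 < s < L -> f s = 0.
Proof.
intros Hc H s Hs. apply NNPP. intros Hf.
(* Multiplying by the constant [f s] treats both signs of [f] at once: near [s] the product
   [f s * f u] is positive, and so is its integral against a bump. *)
assert (Hl : locally s (fun u => 0 < f s * f u /\ 0 < u < L)).
{ apply filter_and.
  - apply (continuous_mult (fun _ => f s) f s (continuous_const _ _) (Hc s Hs)).
    apply (open_gt 0). apply Rsqr_pos_lt, Hf.
  - apply filter_and; [apply (open_gt 0)|apply (open_lt L)]; lra. }
destruct Hl as [e He].
(* Half the radius puts the closed interval, endpoints included, inside the open ball. *)
assert (Hb : forall u, s - e / 2 <= u <= s + e / 2 ->
  0 < f s * f u /\ 0 < u < L).
{ intros u Hu. apply He. destruct e as [e Hep]. simpl in *.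
  apply Rabs_lt_between'. lra. }
assert (Hep := cond_pos e).
set (a := s - e / 2) in *. set (b := s + e / 2) in *.
assert (Hab : a < b) by (unfold a, b; lra).
destruct (bump_exists a b) as (phi & Hphi & Hpos & H0).
destruct (Hb a) as [_ Ha0]; [lra|]. destruct (Hb b) as [_ HbL]; [lra|].
assert (Hz := H phi a b Hphi (proj1 Ha0) Hab (proj2 HbL) H0).
assert (Hcab : forall u, a <= u <= b -> continuous (fun s => f s * phi s) u).
{ intros u Hu. apply (continuous_mult f phi);
    [apply Hc, (Hb u Hu)|apply smooth_continuous, Hphi]. }
assert (Hgt : 0 < RInt (fun u => f s * (f u * phi u)) a b).
{ apply RInt_gt_0; [exact Hab| |].
  - intros u Hu. rewrite <- Rmult_assoc. apply Rmult_lt_0_compat.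
    + apply (Hb u). lra.
    + apply Hpos, Hu.
  - intros u Hu. apply (continuous_mult (fun _ => f s));
      [apply continuous_const|now apply Hcab]. }
assert (Z1 : is_RInt (fun u => f u * phi u) 0 a 0).
{ apply is_RInt_zero. intros u. rewrite Rmin_left, Rmax_right by lra.
  intros Hu. rewrite H0 by lra. ring. }
assert (Z2 : is_RInt (fun u => f u * phi u) b L 0).
{ apply is_RInt_zero. intros u. rewrite Rmin_left, Rmax_right by lra.
  intros Hu. rewrite H0 by lra. ring. }
assert (Hex : ex_RInt (fun u => f u * phi u) a b).
{ apply @ex_RInt_continuous. intros u. rewrite Rmin_left, Rmax_right by lra.
  apply Hcab. }
assert (E : RInt (fun u => f u * phi u) 0 L = RInt (fun u => f u * phi u) a b).
{ apply is_RInt_unique.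
  replace (RInt (fun u => f u * phi u) a b) with
    (plus 0 (plus (RInt (fun u => f u * phi u) a b) 0)) by (unfold plus; simpl; ring).
  apply (is_RInt_Chasles (V := R_NormedModule)) with a; [exact Z1|].
  apply (is_RInt_Chasles (V := R_NormedModule)) with b; [|exact Z2].
  now apply (RInt_correct (V := R_CompleteNormedModule)). }
rewrite Hz in E.
rewrite (RInt_scal (V := R_CompleteNormedModule) (fun u => f u * phi u)) in Hgt
  by exact Hex.
rewrite <- E in Hgt. unfold scal in Hgt; simpl in Hgt.
unfold mult in Hgt; simpl in Hgt. lra.
Qed.

(** The tube lemma: a property that holds near each point of the compact segment [{t0} x [a, b]]
    holds on a strip of uniform width around it. [compactness_value_1d] gives the covering point
    only under a double negation, which is why the conclusion is reached by contradiction. *)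
Lemma tube (Q : R -> R -> Prop) (a b t0 : R) :
  (forall s, a <= s <= b -> locally_2d Q t0 s) ->
  exists d : posreal, forall t s, Rabs (t - t0) < d -> a <= s <= b -> Q t s.
Proof.
intros H.
(* Compactness needs a radius as a function of every real [s]; outside [[a, b]] the value 1 is
   arbitrary. *)
assert (K : forall s, {d : posreal | a <= s <= b ->
  forall t u, Rabs (t - t0) < d -> Rabs (u - s) < d -> Q t u}).
{ intros s. destruct (Rle_dec a s) as [H1|H1]; [destruct (Rle_dec s b) as [H2|H2]|].
  - destruct (locally_2d_ex_dec Q t0 s) as [d Hd];
      [intros; apply classic|apply H; auto|]. exists d. auto.
  - exists (mkposreal 1 Rlt_0_1). lra.
  - exists (mkposreal 1 Rlt_0_1). lra. }
destruct (compactness_value_1d a b (fun s => proj1_sig (K s))) as [d Hd].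
exists d. intros t s Ht Hs. apply NNPP. intros HQ.
apply (Hd s Hs). intros (u & Hu & Hsu & Hdu). apply HQ.
destruct (K u) as [du Hdu']; simpl in *. apply Hdu'; auto. lra.
Qed.

Lemma continuity_2d_pt_snd (g : R -> R) (t s : R) :
  continuous g s -> continuity_2d_pt (fun _ v => g v) t s.
Proof.
intros H. apply (continuity_1d_2d_pt_comp g (fun _ v => v)).
- now apply continuity_pt_filterlim.
- apply continuity_2d_pt_id2.
Qed.

Lemma continuity_2d_pt_comp (g : R -> R) (f : R -> R -> R) (t s : R) :
  continuous g (f t s) -> continuity_2d_pt f t s ->
  continuity_2d_pt (fun u v => g (f u v)) t s.
Proof.
intros H. apply continuity_1d_2d_pt_comp.
now apply continuity_pt_filterlim.
Qed.

Lemma continuity_2d_pt_section (f : R -> R -> R) (t s : R) :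
  continuity_2d_pt f t s -> continuous (f t) s.
Proof.
intros H. apply continuity_pt_filterlim, continuity_pt_locally.
intros eps. apply (locally_2d_1d_const_x _ _ _ (H eps)).
Qed.

Lemma continuity_2d_pt_open (D : R -> Prop) (f : R -> R -> R) (t s : R) :
  open D -> D (f t s) -> continuity_2d_pt f t s ->
  locally_2d (fun u v => D (f u v)) t s.
Proof.
intros HD H Hf. destruct (HD _ H) as [e He].
destruct (Hf e) as [d Hd]. exists d. intros u v Hu Hv.
apply He, Hd; auto.
Qed.

(** * The first variation *)

Definition lagrangian (P : R -> R) (x1 z1 x2 z2 : R) : R :=
  P ((x1 * z2 - x2 * z1) / sqrt (x1 ^ 2 + z1 ^ 2) ^ 3)
  * sqrt (x1 ^ 2 + z1 ^ 2).

(* Here and below, [(x1, z1)] and [(x2, z2)] are the first and second derivatives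
   of the curve, [(f1, g1)] and [(f2, g2)] those of the variation field. *)
Definition lagrangian_variation (P P1 : R -> R)
    (x1 z1 x2 z2 f1 g1 f2 g2 : R) : R :=
  let S := sqrt (x1 ^ 2 + z1 ^ 2) in
  let k := (x1 * z2 - x2 * z1) / S ^ 3 in
  let S' := (x1 * f1 + z1 * g1) / S in
  P1 k * ((f1 * z2 + x1 * g2 - f2 * z1 - x2 * g1) / S ^ 3 - 3 * k * S' / S) * S
  + P k * S'.

(** The curvature integrand has the shape [P(N / S^3) S], with [S] the speed. Keeping [N] and [S]
    abstract keeps the square root out of the algebra. *)
Lemma is_derive_weighted_comp (P N S : R -> R) (t dP N' S' : R) :
  S t <> 0 -> is_derive N t N' -> is_derive S t S' ->
  is_derive P (N t / S t ^ 3) dP ->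
  is_derive (fun t => P (N t / S t ^ 3) * S t) t
    (dP * (N' / S t ^ 3 - 3 * (N t / S t ^ 3) * S' / S t) * S t
     + P (N t / S t ^ 3) * S').
Proof.
intros H0 HN HS HP. auto_derive.
- repeat split; try (eexists; eassumption).
  simpl. rewrite Rmult_1_r. auto using Rmult_integral_contrapositive_currified.
- rewrite <- (is_derive_unique _ _ _ HN), <- (is_derive_unique _ _ _ HS),
    <- (is_derive_unique _ _ _ HP).
  change (Derive (fun x => N x) t) with (Derive N t).
  change (Derive (fun x => S x) t) with (Derive S t).
  change (Derive (fun x => P x)) with (Derive P).
  unfold Rdiv. simpl. rewrite !Rmult_1_r. field. exact H0.
Qed.

Lemma is_derive_lagrangian (P P1 : R -> R) (x1 z1 x2 z2 f1 g1 f2 g2 t : R) :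
  0 < sqrt ((x1 + t * f1) ^ 2 + (z1 + t * g1) ^ 2) ->
  (let k := ((x1 + t * f1) * (z2 + t * g2) - (x2 + t * f2) * (z1 + t * g1))
     / sqrt ((x1 + t * f1) ^ 2 + (z1 + t * g1) ^ 2) ^ 3 in
   is_derive P k (P1 k)) ->
  is_derive
    (fun t => lagrangian P (x1 + t * f1) (z1 + t * g1) (x2 + t * f2) (z2 + t * g2))
    t
    (lagrangian_variation P P1 (x1 + t * f1) (z1 + t * g1) (x2 + t * f2)
       (z2 + t * g2) f1 g1 f2 g2).
Proof.
intros HS HP. cbv zeta in HP. unfold lagrangian, lagrangian_variation.
assert (DS : is_derive (fun t => sqrt ((x1 + t * f1) ^ 2 + (z1 + t * g1) ^ 2)) t
  (((x1 + t * f1) * f1 + (z1 + t * g1) * g1)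
   / sqrt ((x1 + t * f1) ^ 2 + (z1 + t * g1) ^ 2))).
{ auto_derive.
  (* At a nonpositive radicand [sqrt] returns 0, so positive speed forces a positive radicand. *)
  - apply Rnot_le_lt. intros H. simpl in HS. rewrite (sqrt_neg_0 _ H) in HS. lra.
  - simpl in HS |- *. field. lra. }
assert (DN : is_derive (fun t => (x1 + t * f1) * (z2 + t * g2)
    - (x2 + t * f2) * (z1 + t * g1)) t
  (f1 * (z2 + t * g2) + (x1 + t * f1) * g2 - f2 * (z1 + t * g1) - (x2 + t * f2) * g1)).
{ auto_derive; auto. ring. }
evar_last.
{ apply is_derive_weighted_comp with (2 := DN) (3 := DS) (4 := HP). lra. }
cbv beta zeta. ring.
Qed.

(** Openness of [D] lets small variations keep their curvature in it. The third derivative occurs in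
    the Euler-Lagrange operator, whose continuity is needed for the fundamental lemma; [P2 k <> 0]
    lets [kappa' = 0] be read off from [(P'(kappa))_s = 0]. *)
Definition admissible_lagrangian (D : R -> Prop) (P P1 P2 P3 : R -> R) : Prop :=
  open D /\ forall k, D k ->
    is_derive P k (P1 k) /\ is_derive P1 k (P2 k) /\ is_derive P2 k (P3 k) /\
    continuous P3 k /\ P2 k <> 0.

Definition regular_in (D : R -> Prop) (L : R) (x z : R -> R) : Prop :=
  forall s, 0 <= s <= L -> 0 < speed x z s /\ D (curvature x z s).

Lemma is_derive_continuous (f : R -> R) (s l : R) :
  is_derive f s l -> continuous f s.
Proof. intros H. apply (ex_derive_continuous f s). now exists l. Qed.

Lemma smooth_Derive_n2 (f : R -> R) : smooth f -> smooth (Derive_n f 2).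
Proof. intros H. exact (smooth_Derive _ (smooth_Derive _ H)). Qed.

Lemma Derive_affine (x phi : R -> R) (t s : R) : smooth x -> smooth phi ->
  Derive (fun s => x s + t * phi s) s = Derive x s + t * Derive phi s.
Proof.
intros Hx Hp. rewrite Derive_plus.
- now rewrite Derive_scal.
- apply smooth_ex_derive, Hx.
- apply smooth_ex_derive, smooth_scal, Hp.
Qed.

Lemma Derive_n2_affine (x phi : R -> R) (t s : R) : smooth x -> smooth phi ->
  Derive_n (fun s => x s + t * phi s) 2 s = Derive_n x 2 s + t * Derive_n phi 2 s.
Proof.
intros Hx Hp.
change (Derive (Derive (fun s => x s + t * phi s)) s
  = Derive (Derive x) s + t * Derive (Derive phi) s).
rewrite <- Derive_affine by now apply smooth_Derive.
apply Derive_ext. intros u. now apply Derive_affine.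
Qed.

Lemma continuity_2d_pt_affine (g h : R -> R) (t s : R) :
  smooth g -> smooth h -> continuity_2d_pt (fun t s => g s + t * h s) t s.
Proof. intros Hg Hh. apply (smooth2_affine g h Hg Hh 0%nat t s). Qed.

(** Differentiation under the integral sign. The first conclusion, persistence of regularity, comes
    from the same uniform strip and is what makes the affine family a variation within the space. *)
Lemma first_variation (D : R -> Prop) (P P1 P2 P3 : R -> R) (L : R)
    (x z phi psi : R -> R) :
  admissible_lagrangian D P P1 P2 P3 -> 0 < L ->
  smooth x -> smooth z -> smooth phi -> smooth psi ->
  regular_in D L x z ->
  (exists eps, 0 < eps /\ forall t, Rabs t < eps ->
     regular_in D L (fun s => x s + t * phi s) (fun s => z s + t * psi s)) /\
  is_derive
    (fun t => curvature_functional P L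
       (fun s => x s + t * phi s) (fun s => z s + t * psi s)) 0
    (RInt (fun s => lagrangian_variation P P1
       (Derive x s) (Derive z s) (Derive_n x 2 s) (Derive_n z 2 s)
       (Derive phi s) (Derive psi s) (Derive_n phi 2 s) (Derive_n psi 2 s)) 0 L).
Proof.
intros [HD HP] HL Hx Hz Hphi Hpsi Hreg.
set (x1 := fun t s => Derive x s + t * Derive phi s).
set (z1 := fun t s => Derive z s + t * Derive psi s).
set (x2 := fun t s => Derive_n x 2 s + t * Derive_n phi 2 s).
set (z2 := fun t s => Derive_n z 2 s + t * Derive_n psi 2 s).
set (S := fun t s => sqrt (x1 t s ^ 2 + z1 t s ^ 2)).
set (k := fun t s => (x1 t s * z2 t s - x2 t s * z1 t s) / S t s ^ 3).
set (f := fun t s => P (k t s) * S t s).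
set (df := fun t s => lagrangian_variation P P1 (x1 t s) (z1 t s) (x2 t s)
  (z2 t s) (Derive phi s) (Derive psi s) (Derive_n phi 2 s) (Derive_n psi 2 s)).
(* On [Q] the integrand is differentiable in [t] with jointly continuous derivative; [Q] contains a
   strip around [{0} x [0, L]] by compactness. *)
set (Q := fun t s => 0 < S t s /\ D (k t s)).
assert (Espeed : forall t s, speed (fun s => x s + t * phi s)
  (fun s => z s + t * psi s) s = S t s).
{ intros t s. unfold speed, S, x1, z1. now rewrite !Derive_affine. }
assert (Ecurv : forall t s, curvature (fun s => x s + t * phi s)
  (fun s => z s + t * psi s) s = k t s).
{ intros t s. unfold curvature, k, x2, z2. rewrite Espeed.
  rewrite !Derive_n2_affine by assumption. unfold x1, z1.
  now rewrite !Derive_affine. }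
assert (Hsm := smooth_Derive). assert (Hsm2 := smooth_Derive_n2).
assert (Cx1 : forall t s, continuity_2d_pt x1 t s)
  by (intros; apply continuity_2d_pt_affine; auto).
assert (Cz1 : forall t s, continuity_2d_pt z1 t s)
  by (intros; apply continuity_2d_pt_affine; auto).
assert (Cx2 : forall t s, continuity_2d_pt x2 t s)
  by (intros; apply continuity_2d_pt_affine; auto).
assert (Cz2 : forall t s, continuity_2d_pt z2 t s)
  by (intros; apply continuity_2d_pt_affine; auto).
assert (CS : forall t s, continuity_2d_pt S t s).
{ intros t s. unfold S.
  apply (continuity_2d_pt_comp sqrt (fun t s => x1 t s ^ 2 + z1 t s ^ 2));
    [apply continuous_sqrt|]. simpl.
  repeat first [solve [auto]|apply continuity_2d_pt_plus|apply continuity_2d_pt_mult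
    |apply continuity_2d_pt_const]; auto. }
assert (Cinv : forall t s, 0 < S t s -> continuity_2d_pt (fun t s => / S t s) t s).
{ intros t s H. apply continuity_2d_pt_inv; [apply CS|lra]. }
assert (Cinv3 : forall t s, 0 < S t s ->
  continuity_2d_pt (fun t s => / S t s ^ 3) t s).
{ intros t s H. apply continuity_2d_pt_inv.
  - simpl. repeat first [solve [auto]|apply continuity_2d_pt_mult
      |apply continuity_2d_pt_const]; auto.
  - apply pow_nonzero. lra. }
assert (Ck : forall t s, 0 < S t s -> continuity_2d_pt k t s).
{ intros t s H. unfold k, Rdiv.
  apply continuity_2d_pt_mult; [|now apply Cinv3].
  apply continuity_2d_pt_minus; apply continuity_2d_pt_mult; auto. }
assert (HQ0 : forall s, 0 <= s <= L -> Q 0 s).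
{ intros s Hs. destruct (Hreg s Hs) as [H1 H2].
  assert (E1 : forall a b, a + 0 * b = a) by (intros; ring).
  unfold Q, k, S, x1, z1, x2, z2. rewrite !E1. split; assumption. }
assert (HQ : forall s, 0 <= s <= L -> locally_2d Q 0 s).
{ intros s Hs. destruct (HQ0 s Hs) as [H1 H2]. apply locally_2d_and.
  - apply (continuity_2d_pt_open (fun y => 0 < y)); auto. apply open_gt.
  - apply continuity_2d_pt_open; auto. }
destruct (tube Q 0 L 0 HQ) as [eps Heps].
assert (HdQ : forall t s, Q t s -> is_derive (fun t => f t s) t (df t s)).
{ intros t s [H1 H2]. apply is_derive_lagrangian; [exact H1|]. apply HP, H2. }
assert (Cf : forall t s, Q t s -> continuous (f t) s).
{ intros t s [H1 H2]. apply continuity_2d_pt_section, continuity_2d_pt_mult; auto.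
  apply continuity_2d_pt_comp; auto.
  destruct (HP _ H2) as (HP0 & _). eapply is_derive_continuous, HP0. }
assert (Cdf : forall t s, Q t s -> continuity_2d_pt df t s).
{ intros t s [H1 H2]. destruct (HP _ H2) as (HP0 & HP1 & _).
  assert (CP : continuity_2d_pt (fun t s => P (k t s)) t s).
  { apply continuity_2d_pt_comp; auto. eapply is_derive_continuous, HP0. }
  assert (CP1 : continuity_2d_pt (fun t s => P1 (k t s)) t s).
  { apply continuity_2d_pt_comp; auto. eapply is_derive_continuous, HP1. }
  (* Quotients are displayed as products with inverses, so that [Cinv] and [Cinv3] apply. *)
  change (continuity_2d_pt (fun t s => P1 (k t s) *
    ((Derive phi s * z2 t s + x1 t s * Derive_n psi 2 s
      - Derive_n phi 2 s * z1 t s - x2 t s * Derive psi s) * / S t s ^ 3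
     - 3 * k t s * ((x1 t s * Derive phi s + z1 t s * Derive psi s) * / S t s)
       * / S t s) * S t s
    + P (k t s) * ((x1 t s * Derive phi s + z1 t s * Derive psi s) * / S t s))
    t s).
  assert (C1 : forall g, smooth g -> continuity_2d_pt (fun _ s => g s) t s).
  { intros g Hg. apply continuity_2d_pt_snd, smooth_continuous, Hg. }
  assert (C2 : continuity_2d_pt (fun _ s => Derive phi s) t s) by (apply C1; auto).
  assert (C3 : continuity_2d_pt (fun _ s => Derive psi s) t s) by (apply C1; auto).
  assert (C4 : continuity_2d_pt (fun _ s => Derive_n phi 2 s) t s) by (apply C1; auto).
  assert (C5 : continuity_2d_pt (fun _ s => Derive_n psi 2 s) t s) by (apply C1; auto).
  repeat first [assumption | solve [auto]
    |apply continuity_2d_pt_minus|apply continuity_2d_pt_plus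
    |apply continuity_2d_pt_mult|apply continuity_2d_pt_const]. }
split.
- exists eps. split; [apply cond_pos|]. intros t Ht s Hs.
  rewrite Espeed, Ecurv. apply Heps; [|exact Hs]. now rewrite Rminus_0_r.
- assert (Hnear : locally 0 (fun t => forall s, 0 <= s <= L -> Q t s)).
  { exists eps. intros t Ht s Hs. now apply Heps. }
  replace (RInt _ 0 L) with (RInt (fun s => Derive (fun t => f t s) 0) 0 L).
  2:{ apply RInt_ext. rewrite Rmin_left, Rmax_right by lra. intros s Hs.
      transitivity (df 0 s); [apply is_derive_unique, HdQ, HQ0; lra|].
      assert (E1 : forall a b, a + 0 * b = a) by (intros; ring).
      unfold df, x1, x2, z1, z2. now rewrite !E1. }
  apply is_derive_ext with (fun t => RInt (fun s => f t s) 0 L).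
  { intros t. apply RInt_ext. intros s _. unfold f. now rewrite Espeed, Ecurv. }
  apply is_derive_RInt_param; rewrite ?Rmin_left, ?Rmax_right by lra.
  + apply filter_imp with (2 := Hnear). intros t Ht s Hs.
    exists (df t s). now apply HdQ, Ht.
  + intros s Hs. apply continuity_2d_pt_ext_loc with df.
    * destruct (HQ s Hs) as [d Hd]. exists d. intros u v Hu Hv.
      symmetry. apply is_derive_unique, HdQ. now apply Hd.
    * apply Cdf, HQ0, Hs.
  + apply filter_imp with (2 := Hnear). intros t Ht.
    apply @ex_RInt_continuous. rewrite Rmin_left, Rmax_right by lra.
    intros s Hs. apply Cf, Ht, Hs.
Qed.

(** * Unit-speed curves, up to the endpoints *)

Lemma RInt_ext_open (f g : R -> R) (a b : R) : a <= b ->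
  (forall s, a < s < b -> f s = g s) -> RInt f a b = RInt g a b.
Proof.
intros Hab H. apply RInt_ext. rewrite Rmin_left, Rmax_right by exact Hab. exact H.
Qed.

Lemma continuous_eq_closed (f g : R -> R) (L : R) : 0 < L ->
  (forall s, 0 <= s <= L -> continuous f s) ->
  (forall s, 0 <= s <= L -> continuous g s) ->
  (forall s, 0 < s < L -> f s = g s) ->
  forall s, 0 <= s <= L -> f s = g s.
Proof.
intros HL Hf Hg E s Hs. apply Rminus_diag_uniq. apply NNPP. intros H0.
assert (Hc : continuous (fun u => f u - g u) s)
  by (apply (continuous_minus f g); auto).
destruct (Hc (fun y => y <> 0) (open_neq 0 _ H0)) as [e He].
assert (Hep := cond_pos e).
(* The point [s + tau (L/2 - s)] is [s] pushed towards the midpoint: it is interior even if [s] is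
   an endpoint, and [tau * L <= e] keeps it within distance [e] of [s]. *)
set (tau := Rmin (/ 2) (e / L)).
assert (Ht0 : 0 < tau) by (apply Rmin_pos; [lra|now apply Rdiv_lt_0_compat]).
assert (Ht1 : tau <= / 2) by apply Rmin_l.
assert (Ht2 : tau * L <= e).
{ apply Rle_trans with (e / L * L); [|right; field; lra].
  apply Rmult_le_compat_r; [lra|apply Rmin_r]. }
apply (He (s + tau * (L / 2 - s))).
- apply Rabs_lt_between'.
  assert (tau * s <= tau * L) by (apply Rmult_le_compat_l; lra).
  assert (0 <= tau * s) by (apply Rmult_le_pos; lra).
  assert (0 < tau * L) by (apply Rmult_lt_0_compat; lra). lra.
- rewrite E; [lra|].
  assert ((/ 2 - tau) * s >= 0) by (apply Rle_ge, Rmult_le_pos; lra).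
  assert ((1 - tau) * (L - s) >= 0) by (apply Rle_ge, Rmult_le_pos; lra).
  assert ((1 - tau) * s >= 0) by (apply Rle_ge, Rmult_le_pos; lra).
  assert (0 < tau * L) by (apply Rmult_lt_0_compat; lra). lra.
Qed.

(** The equations [x' = cos theta], [z' = sin theta] are differentiated in the open interval, where
    they hold in a neighbourhood; both sides being continuous, the result extends to 0 and [L]. *)
Lemma arc_length_second_derivatives (L : R) (x z theta : R -> R) :
  0 < L -> arc_length_curve L x z theta -> forall s, 0 <= s <= L ->
  Derive_n x 2 s = - Derive theta s * sin (theta s) /\
  Derive_n z 2 s = Derive theta s * cos (theta s).
Proof.
intros HL (Hx & Hz & Ht & H).
assert (Hd : forall s, ex_derive theta s) by (intros; now apply smooth_ex_derive).
assert (Hloc : forall s, 0 < s < L -> locally s (fun u => 0 <= u <= L)).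
{ intros s Hs. apply (filter_imp (fun u => 0 < u /\ u < L)); [intros u; lra|].
  apply filter_and; [apply (open_gt 0)|apply (open_lt L)]; lra. }
assert (Hd2 : forall s, ex_derive (Derive theta) s)
  by (intros; now apply smooth_ex_derive, smooth_Derive).
intros s Hs. split; revert s Hs; apply continuous_eq_closed; try exact HL.
- intros s _. apply smooth_continuous, smooth_Derive_n2, Hx.
- intros s _. apply (ex_derive_continuous (fun s => - Derive theta s * sin (theta s))).
  auto_derive. split; [apply Hd2|]. auto.
- intros s Hs. simpl. rewrite (Derive_ext_loc _ (fun u => cos (theta u))).
  + apply is_derive_unique. auto_derive; [apply Hd|].
    change (Derive (fun v => theta v)) with (Derive theta). ring.
  + apply filter_imp with (2 := Hloc s Hs). intros u Hu. apply (H u Hu).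
- intros s _. apply smooth_continuous, smooth_Derive_n2, Hz.
- intros s _. apply (ex_derive_continuous (fun s => Derive theta s * cos (theta s))).
  auto_derive. split; [apply Hd2|]. auto.
- intros s Hs. simpl. rewrite (Derive_ext_loc _ (fun u => sin (theta u))).
  + apply is_derive_unique. auto_derive; [apply Hd|].
    change (Derive (fun v => theta v)) with (Derive theta). ring.
  + apply filter_imp with (2 := Hloc s Hs). intros u Hu. apply (H u Hu).
Qed.

Lemma sqrt_cos2_sin2 (t : R) : sqrt (cos t ^ 2 + sin t ^ 2) = 1.
Proof.
rewrite <- sqrt_1. f_equal. pose proof (sin2_cos2 t) as T. unfold Rsqr in T. simpl. lra.
Qed.

Lemma curvature_arc_length_closed (L : R) (x z theta : R -> R) (s : R) :
  0 < L -> arc_length_curve L x z theta -> 0 <= s <= L ->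
  curvature x z s = Derive theta s.
Proof.
intros HL Harc Hs.
destruct (arc_length_second_derivatives _ _ _ _ HL Harc s Hs) as [E1 E2].
destruct Harc as (_ & _ & _ & H). destruct (H s Hs) as [D1 D2].
unfold curvature, speed. rewrite E1, E2, D1, D2, sqrt_cos2_sin2.
pose proof (sin2_cos2 (theta s)) as T. unfold Rsqr in T.
transitivity (Derive theta s *
  (sin (theta s) * sin (theta s) + cos (theta s) * cos (theta s))).
- field.
- rewrite T. ring.
Qed.

Lemma Derive_outside_support (phi : R -> R) (a b s : R) :
  (forall u, u <= a \/ b <= u -> phi u = 0) -> s < a \/ b < s ->
  Derive phi s = 0.
Proof.
intros H Hs. rewrite (Derive_ext_loc _ (fun _ => 0)); [apply Derive_const|].
destruct Hs as [Hs|Hs].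
- apply (filter_imp (fun u => u < a)); [intros u Hu; apply H; lra|].
  now apply (open_lt a).
- apply (filter_imp (fun u => b < u)); [intros u Hu; apply H; lra|].
  now apply (open_gt b).
Qed.

(** * The Euler-Lagrange equation *)

Ltac split_continuous :=
  repeat lazymatch goal with
  | |- continuous (fun _ => ?c) _ => apply continuous_const
  | |- continuous (fun s => _ + _) _ => apply (continuous_plus (V := R_NormedModule))
  | |- continuous (fun s => _ - _) _ => apply (continuous_minus (V := R_NormedModule))
  | |- continuous (fun s => _ * _) _ => apply (continuous_mult (K := R_AbsRing))
  | |- continuous (fun s => cos _) _ => apply continuous_cos_comp
  | |- continuous (fun s => sin _) _ => apply continuous_sin_comp
  end.

(* The components of the conserved vector [J]. *)
Definition force_x (P P1 P2 theta : R -> R) (s : R) : R :=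
  (Derive theta s * P1 (Derive theta s) - P (Derive theta s)) * cos (theta s)
  - P2 (Derive theta s) * Derive_n theta 2 s * sin (theta s).

Definition force_z (P P1 P2 theta : R -> R) (s : R) : R :=
  (Derive theta s * P1 (Derive theta s) - P (Derive theta s)) * sin (theta s)
  + P2 (Derive theta s) * Derive_n theta 2 s * cos (theta s).

(** The expanded form of [(P'(kappa))_ss + kappa (kappa P'(kappa) - P(kappa))] with
    [kappa = theta'], the factor of the normal component of the field in the first variation. *)
Definition euler_lagrange (P P1 P2 P3 theta : R -> R) (s : R) : R :=
  P3 (Derive theta s) * Derive_n theta 2 s ^ 2
  + P2 (Derive theta s) * Derive_n theta 3 s
  + Derive theta s
    * (Derive theta s * P1 (Derive theta s) - P (Derive theta s)).

(** This is [J' = E N] with [N = (- sin theta, cos theta)]. By [T' = kappa N] and [N' = - kappa T]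
    the tangential part of [J'] is [(kappa P' - P)_s - kappa (P')_s], which cancels. *)
Lemma is_derive_force (D : R -> Prop) (P P1 P2 P3 theta : R -> R) (s : R) :
  admissible_lagrangian D P P1 P2 P3 -> smooth theta -> D (Derive theta s) ->
  is_derive (force_x P P1 P2 theta) s
    (- sin (theta s) * euler_lagrange P P1 P2 P3 theta s) /\
  is_derive (force_z P P1 P2 theta) s
    (cos (theta s) * euler_lagrange P P1 P2 P3 theta s).
Proof.
intros [_ HP] Ht HD. destruct (HP _ HD) as (H0 & H1 & H2 & _).
unfold force_x, force_z, euler_lagrange.
set (K1 := Derive_n theta 2). change (Derive_n theta 3) with (Derive K1).
set (K := Derive theta) in *.
assert (HK : is_derive K s (K1 s)) by (apply smooth_is_derive, smooth_Derive, Ht).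
assert (HK1 : is_derive K1 s (Derive K1 s))
  by (apply smooth_is_derive, smooth_Derive_n2, Ht).
assert (HT : is_derive theta s (K s)) by (apply smooth_is_derive, Ht).
split; auto_derive; repeat split; try (eexists; eassumption);
  change (Derive (fun x => P x)) with (Derive P);
  change (Derive (fun x => P1 x)) with (Derive P1);
  change (Derive (fun x => P2 x)) with (Derive P2);
  change (Derive (fun x => K x)) with K1;
  change (Derive (fun x => K1 x)) with (Derive K1);
  change (Derive (fun x => theta x)) with K;
  rewrite ?(is_derive_unique _ _ _ H0), ?(is_derive_unique _ _ _ H1),
    ?(is_derive_unique _ _ _ H2); ring.
Qed.

Lemma continuous_euler_lagrange (D : R -> Prop) (P P1 P2 P3 theta : R -> R) (s : R) :
  admissible_lagrangian D P P1 P2 P3 -> smooth theta -> D (Derive theta s) ->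
  continuous (euler_lagrange P P1 P2 P3 theta) s.
Proof.
intros [_ HP] Ht HD. destruct (HP _ HD) as (H0 & H1 & H2 & H3 & _).
assert (CK : continuous (Derive theta) s)
  by (apply smooth_continuous, smooth_Derive, Ht).
assert (CK1 : continuous (Derive_n theta 2) s)
  by (apply smooth_continuous, smooth_Derive_n2, Ht).
assert (CK2 : continuous (Derive_n theta 3) s)
  by (apply smooth_continuous, smooth_Derive, smooth_Derive_n2, Ht).
assert (C : forall Q : R -> R, continuous Q (Derive theta s) ->
  continuous (fun s => Q (Derive theta s)) s)
  by (intros Q HQ; now apply (continuous_comp (Derive theta) Q)).
assert (C0 := C P (is_derive_continuous _ _ _ H0)).
assert (C1 := C P1 (is_derive_continuous _ _ _ H1)).
assert (C2 := C P2 (is_derive_continuous _ _ _ H2)).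
assert (C3 := C P3 H3).
unfold euler_lagrange. simpl pow. split_continuous; assumption.
Qed.

(* The integrand of the first variation differs by an exact derivative from
   the Euler-Lagrange operator times the normal component of the field. *)
Lemma is_derive_boundary_term (D : R -> Prop) (P P1 P2 P3 theta phi psi : R -> R)
    (s : R) :
  admissible_lagrangian D P P1 P2 P3 -> smooth theta -> smooth phi ->
  smooth psi -> D (Derive theta s) ->
  is_derive (fun s => P1 (Derive theta s)
      * (cos (theta s) * Derive psi s - sin (theta s) * Derive phi s)
      - force_x P P1 P2 theta s * phi s - force_z P P1 P2 theta s * psi s) s
    (P1 (Derive theta s)
     * (cos (theta s) * Derive_n psi 2 s - sin (theta s) * Derive_n phi 2 s
        - 2 * Derive theta s
          * (cos (theta s) * Derive phi s + sin (theta s) * Derive psi s))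
     + P (Derive theta s)
       * (cos (theta s) * Derive phi s + sin (theta s) * Derive psi s)
     - euler_lagrange P P1 P2 P3 theta s
       * (cos (theta s) * psi s - sin (theta s) * phi s)).
Proof.
intros HP Ht Hphi Hpsi HD.
destruct (is_derive_force _ _ _ _ _ _ _ HP Ht HD) as [HX HZ].
destruct HP as [_ HP]. destruct (HP _ HD) as (_ & H1 & _).
assert (HT : is_derive theta s (Derive theta s)) by (apply smooth_is_derive, Ht).
assert (HK : is_derive (Derive theta) s (Derive_n theta 2 s))
  by (apply smooth_is_derive, smooth_Derive, Ht).
assert (Hf : is_derive phi s (Derive phi s)) by (apply smooth_is_derive, Hphi).
assert (Hg : is_derive psi s (Derive psi s)) by (apply smooth_is_derive, Hpsi).
assert (Hf1 : is_derive (Derive phi) s (Derive_n phi 2 s))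
  by (apply smooth_is_derive, smooth_Derive, Hphi).
assert (Hg1 : is_derive (Derive psi) s (Derive_n psi 2 s))
  by (apply smooth_is_derive, smooth_Derive, Hpsi).
set (X := force_x P P1 P2 theta) in *. set (Z := force_z P P1 P2 theta) in *.
assert (EX : X s = force_x P P1 P2 theta s) by easy.
assert (EZ : Z s = force_z P P1 P2 theta s) by easy.
(* The components of [J] become opaque functions with known derivative ([HX], [HZ]) and known value
   ([EX], [EZ]), so they are not differentiated again. *)
clearbody X Z. unfold force_x in EX. unfold force_z in EZ.
set (K1 := Derive_n theta 2) in *. set (K := Derive theta) in *.
set (f1 := Derive phi) in *. set (g1 := Derive psi) in *.
set (f2 := Derive_n phi 2) in *. set (g2 := Derive_n psi 2) in *.
auto_derive; repeat split; try (eexists; eassumption).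
change (Derive (fun x => P1 x)) with (Derive P1).
change (Derive (fun x => K x)) with K1.
change (Derive (fun x => theta x)) with K.
change (Derive (fun x => phi x)) with f1.
change (Derive (fun x => psi x)) with g1.
change (Derive (fun x => f1 x)) with f2.
change (Derive (fun x => g1 x)) with g2.
change (Derive (fun x => X x)) with (Derive X).
change (Derive (fun x => Z x)) with (Derive Z).
rewrite (is_derive_unique _ _ _ H1), (is_derive_unique _ _ _ HX),
  (is_derive_unique _ _ _ HZ), EX, EZ.
pose proof (sin2_cos2 (theta s)) as T. unfold Rsqr in T.
ring.
Qed.

Definition critical_along (P : R -> R) (L : R) (x z phi psi : R -> R) : Prop :=
  is_derive (fun t => curvature_functional P L
    (fun s => x s + t * phi s) (fun s => z s + t * psi s)) 0 0.

(** Integration by parts in one stroke: the first-variation integrand [V] and the Euler-Lagrange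
    integrand [W] differ by the derivative of the boundary term, which vanishes at both ends. *)
Lemma first_variation_arc_length (D : R -> Prop) (P P1 P2 P3 : R -> R) (L : R)
    (x z theta phi psi : R -> R) (a b : R) :
  admissible_lagrangian D P P1 P2 P3 -> 0 < L ->
  arc_length_curve L x z theta -> regular_in D L x z ->
  smooth phi -> smooth psi -> 0 < a -> b < L ->
  (forall s, s <= a \/ b <= s -> phi s = 0) ->
  (forall s, s <= a \/ b <= s -> psi s = 0) ->
  critical_along P L x z phi psi ->
  RInt (fun s => euler_lagrange P P1 P2 P3 theta s
       * (cos (theta s) * psi s - sin (theta s) * phi s)) 0 L = 0.
Proof.
intros HP HL Harc Hreg Hphi Hpsi Ha Hb Zphi Zpsi Hcr.
assert (HD : forall s, 0 <= s <= L -> D (Derive theta s)).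
{ intros s Hs.
  rewrite <- (curvature_arc_length_closed _ _ _ _ s HL Harc Hs). now apply Hreg. }
assert (HA := arc_length_second_derivatives _ _ _ _ HL Harc).
destruct Harc as (Hx & Hz & Ht & Harc).
destruct (first_variation D P P1 P2 P3 L x z phi psi HP HL Hx Hz Hphi Hpsi Hreg)
  as [_ HV].
apply is_derive_unique in HV. unfold critical_along in Hcr.
apply is_derive_unique in Hcr. rewrite Hcr in HV. clear Hcr.
set (V := fun s => P1 (Derive theta s)
     * (cos (theta s) * Derive_n psi 2 s - sin (theta s) * Derive_n phi 2 s
        - 2 * Derive theta s
          * (cos (theta s) * Derive phi s + sin (theta s) * Derive psi s))
     + P (Derive theta s)
       * (cos (theta s) * Derive phi s + sin (theta s) * Derive psi s)).
set (W := fun s => euler_lagrange P P1 P2 P3 theta s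
       * (cos (theta s) * psi s - sin (theta s) * phi s)).
change (RInt W 0 L = 0).
(* [V] is the general first-variation integrand evaluated at unit speed. *)
assert (EV : RInt V 0 L = 0).
{ etransitivity; [|symmetry; exact HV]. apply RInt_ext_open; [lra|]. intros s Hs.
  destruct (HA s) as [A1 A2]; [lra|]. destruct (Harc s) as [B1 B2]; [lra|].
  unfold V, lagrangian_variation. cbv zeta.
  rewrite A1, A2, B1, B2, sqrt_cos2_sin2.
  pose proof (sin2_cos2 (theta s)) as T. unfold Rsqr in T.
  replace ((cos (theta s) * (Derive theta s * cos (theta s)) -
    - Derive theta s * sin (theta s) * sin (theta s)) / 1 ^ 3)
    with (Derive theta s
      * (sin (theta s) * sin (theta s) + cos (theta s) * cos (theta s)))
    by field.
  rewrite T, !Rmult_1_r. field. }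
assert (Cth : forall s, continuous theta s) by (intros; now apply smooth_continuous).
assert (CW : forall s, 0 <= s <= L -> continuous W s).
{ intros s Hs. apply (continuous_mult (K := R_AbsRing)).
  - apply continuous_euler_lagrange with D; auto.
  - apply (continuous_minus (V := R_NormedModule));
      apply (continuous_mult (K := R_AbsRing)); auto using smooth_continuous.
    + apply continuous_cos_comp, Cth.
    + apply continuous_sin_comp, Cth. }
assert (CV : forall s, 0 <= s <= L -> continuous V s).
{ intros s Hs. destruct HP as [_ HP]. destruct (HP _ (HD s Hs)) as (H0 & H1 & _).
  assert (C : forall (Q : R -> R) (l : R), is_derive Q (Derive theta s) l ->
    continuous (fun s => Q (Derive theta s)) s).
  { intros Q l HQ. apply (continuous_comp (Derive theta) Q).
    - apply smooth_continuous, smooth_Derive, Ht.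
    - eapply is_derive_continuous, HQ. }
  assert (C0 := C P _ H0). assert (C1 := C P1 _ H1).
  unfold V. split_continuous;
    auto using smooth_continuous, smooth_Derive, smooth_Derive_n2. }
assert (HI : is_RInt (fun s => V s - W s) 0 L 0).
{ evar_last.
  - apply (is_RInt_derive (V := R_CompleteNormedModule)) with (f := fun s => P1 (Derive theta s)
      * (cos (theta s) * Derive psi s - sin (theta s) * Derive phi s)
      - force_x P P1 P2 theta s * phi s - force_z P P1 P2 theta s * psi s);
      rewrite Rmin_left, Rmax_right by lra; intros s Hs.
    + apply is_derive_boundary_term with D; auto.
    + apply (continuous_minus (V := R_NormedModule)); auto.
  (* Since [0 < a] and [b < L], the fields vanish near both endpoints, and so do their derivatives
     there. *)
  - cbv beta. rewrite (Derive_outside_support phi a b 0), (Derive_outside_support phi a b L),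
      (Derive_outside_support psi a b 0), (Derive_outside_support psi a b L),
      (Zphi 0), (Zphi L), (Zpsi 0), (Zpsi L) by (auto; lra).
    unfold minus, plus, opp; simpl. ring. }
apply (is_RInt_unique (V := R_CompleteNormedModule)) in HI.
rewrite (RInt_minus (V := R_CompleteNormedModule) V W) in HI.
- rewrite EV in HI. unfold minus, plus, opp in HI; simpl in HI. lra.
- apply @ex_RInt_continuous. rewrite Rmin_left, Rmax_right by lra. exact CV.
- apply @ex_RInt_continuous. rewrite Rmin_left, Rmax_right by lra. exact CW.
Qed.

(** The fields [(0, phi)] and [(phi, 0)] have normal components [phi cos theta] and
    [- phi sin theta], so the operator times [cos theta] and times [sin theta] vanishes inside the
    interval; [sin^2 + cos^2 = 1] recovers the operator itself. *)
Lemma euler_lagrange_zero (D : R -> Prop) (P P1 P2 P3 : R -> R) (L : R)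
    (x z theta : R -> R) :
  admissible_lagrangian D P P1 P2 P3 -> 0 < L ->
  arc_length_curve L x z theta -> regular_in D L x z ->
  (forall phi psi a b, smooth phi -> smooth psi -> 0 < a -> b < L ->
     (forall s, s <= a \/ b <= s -> phi s = 0) ->
     (forall s, s <= a \/ b <= s -> psi s = 0) ->
     critical_along P L x z phi psi) ->
  forall s, 0 <= s <= L -> euler_lagrange P P1 P2 P3 theta s = 0.
Proof.
intros HP HL Harc Hreg Hcr.
assert (HD : forall s, 0 <= s <= L -> D (Derive theta s)).
{ intros s Hs.
  rewrite <- (curvature_arc_length_closed _ _ _ _ s HL Harc Hs). now apply Hreg. }
assert (Ht : smooth theta) by apply Harc.
assert (Cth : forall s, continuous theta s) by (intros; now apply smooth_continuous).
assert (CE : forall s, 0 <= s <= L -> continuous (euler_lagrange P P1 P2 P3 theta) s)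
  by (intros; apply continuous_euler_lagrange with D; auto).
apply continuous_eq_closed with (g := fun _ => 0); auto using continuous_const.
assert (Hcos : forall s, 0 < s < L ->
  euler_lagrange P P1 P2 P3 theta s * cos (theta s) = 0).
{ apply fundamental_lemma.
  - intros s Hs. apply (continuous_mult (K := R_AbsRing)).
    + apply CE. lra.
    + apply continuous_cos_comp, Cth.
  - intros phi a b Hphi Ha _ Hb H0.
    etransitivity;
      [|apply (first_variation_arc_length D P P1 P2 P3 L x z theta (fun _ => 0) phi a b);
        eauto using smooth_const].
    apply RInt_ext_open; [lra|]. intros s _. ring. }
assert (Hsin : forall s, 0 < s < L ->
  euler_lagrange P P1 P2 P3 theta s * - sin (theta s) = 0).
{ apply fundamental_lemma.
  - intros s Hs. apply (continuous_mult (K := R_AbsRing)).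
    + apply CE. lra.
    + apply (continuous_opp (V := R_NormedModule)), continuous_sin_comp, Cth.
  - intros phi a b Hphi Ha _ Hb H0.
    etransitivity;
      [|apply (first_variation_arc_length D P P1 P2 P3 L x z theta phi (fun _ => 0) a b);
        eauto using smooth_const].
    apply RInt_ext_open; [lra|]. intros s _. ring. }
intros s Hs. specialize (Hcos s Hs). specialize (Hsin s Hs).
pose proof (sin2_cos2 (theta s)) as T. unfold Rsqr in T.
rewrite <- (Rmult_1_r (euler_lagrange P P1 P2 P3 theta s)), <- T.
transitivity (- sin (theta s) * (euler_lagrange P P1 P2 P3 theta s * - sin (theta s))
  * 1 + cos (theta s) * (euler_lagrange P P1 P2 P3 theta s * cos (theta s))); [ring|].
rewrite Hcos, Hsin. ring.
Qed.

(** The affine family is a legitimate variation: it is smooth in both variables, stays regular by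
    [first_variation], and keeps the endpoints because the fields vanish there. The equivalence for
    [Space] is the common form of [Omega] and [Omega_star]. *)
Lemma critical_critical_along (Space : (R -> R) -> (R -> R) -> Prop)
    (D : R -> Prop) (P P1 P2 P3 : R -> R) (L : R) (p0 p1 : R * R)
    (x z : R -> R) :
  admissible_lagrangian D P P1 P2 P3 -> 0 < L ->
  (forall X Z, Space X Z <-> Omega L p0 p1 X Z /\ regular_in D L X Z) ->
  critical Space (curvature_functional P L) L x z ->
  forall phi psi a b, smooth phi -> smooth psi -> 0 < a -> b < L ->
    (forall s, s <= a \/ b <= s -> phi s = 0) ->
    (forall s, s <= a \/ b <= s -> psi s = 0) ->
    critical_along P L x z phi psi.
Proof.
intros HP HL HS [Hxz Hcr] phi psi a b Hphi Hpsi Ha Hb Zphi Zpsi.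
apply HS in Hxz. destruct Hxz as [(Hx & Hz & _ & E0 & E1) Hreg].
apply (Hcr (fun t s => x s + t * phi s) (fun t s => z s + t * psi s)).
split; [now apply smooth2_affine|]. split; [now apply smooth2_affine|].
split; [intros s _; split; ring|]. split.
- destruct (first_variation D P P1 P2 P3 L x z phi psi HP HL Hx Hz Hphi Hpsi Hreg)
    as [(eps & Heps & H) _].
  exists eps. split; [exact Heps|]. intros t Ht. apply HS. split; [|now apply H].
  split; [now apply smooth_plus; [|apply smooth_scal]|].
  split; [now apply smooth_plus; [|apply smooth_scal]|].
  split; [intros u Hu; now apply (H t Ht u)|].
  rewrite (Zphi 0), (Zphi L), (Zpsi 0), (Zpsi L) by lra.
  rewrite Rmult_0_r, !Rplus_0_r. auto.
- exists a, b. split; [exact Ha|]. split; [exact Hb|]. intros s _ Hs.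
  rewrite Zphi, Zpsi by lra.
  split; apply is_derive_unique; auto_derive; auto; ring.
Qed.

(** * Position and Weingarten relation *)

(** Polar coordinates measured from the second axis: the angle is [acos (v / r)] with the sign of
    [u]. *)
Lemma angle_exists (u v : R) : 0 < u ^ 2 + v ^ 2 ->
  exists phi, u = sqrt (u ^ 2 + v ^ 2) * sin phi /\
              v = sqrt (u ^ 2 + v ^ 2) * cos phi.
Proof.
intros H. set (r := sqrt (u ^ 2 + v ^ 2)).
assert (Hr : 0 < r) by now apply sqrt_lt_R0.
assert (Er : r * r = u ^ 2 + v ^ 2) by (apply sqrt_sqrt; lra).
assert (Hv : -1 <= v / r <= 1).
{ assert (Hvr : Rabs v <= r).
  { apply Rsqr_incr_0; [|apply Rabs_pos|lra]. rewrite <- Rsqr_abs.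
    unfold Rsqr. rewrite Er. pose proof (pow2_ge_0 u). simpl in *. lra. }
  apply Rabs_le_between in Hvr.
  split; apply Rmult_le_reg_r with r; try exact Hr;
    replace (v / r * r) with v by (field; lra); lra. }
assert (Hs : sin (acos (v / r)) = Rabs (u / r)).
{ rewrite sin_acos, <- sqrt_Rsqr_abs by exact Hv. f_equal.
  unfold Rsqr. apply Rmult_eq_reg_r with (r * r); [|nra].
  transitivity (r * r - v * v); [field; lra|].
  transitivity (u * u); [rewrite Er; ring|field; lra]. }
assert (Hc : cos (acos (v / r)) = v / r) by now apply cos_acos.
destruct (Rle_lt_dec 0 u) as [Hu|Hu].
- exists (acos (v / r)). rewrite Hs, Hc, Rabs_pos_eq.
  + split; field; lra.
  + now apply Rdiv_le_0_compat.
- exists (- acos (v / r)). rewrite sin_neg, cos_neg, Hs, Hc, Rabs_left.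
  + split; field; lra.
  + unfold Rdiv. rewrite Rmult_comm. rewrite <- (Rmult_0_r (/ r)).
    apply Rmult_lt_compat_l; [now apply Rinv_0_lt_compat|exact Hu].
Qed.

Lemma is_derive_zero_const (f : R -> R) (L : R) :
  (forall s, 0 <= s <= L -> is_derive f s 0) ->
  forall s, 0 <= s <= L -> f s = f 0.
Proof.
intros H s [[Hs|Hs] HsL]; [|now subst].
symmetry. apply (eq_is_derive (V := R_NormedModule)); [|exact Hs].
intros t Ht. apply H. lra.
Qed.

Lemma is_derive_move (L : R) (x z theta : R -> R) (phi c1 c2 s : R) :
  arc_length_curve L x z theta -> 0 <= s <= L ->
  is_derive (move_x phi c1 x z) s (cos (theta s + phi)) /\
  is_derive (move_z phi c2 x z) s (sin (theta s + phi)).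
Proof.
intros (Hx & Hz & _ & H) Hs. destruct (H s Hs) as [Ex Ez].
rewrite cos_plus, sin_plus.
assert (Dx := smooth_is_derive x s Hx). assert (Dz := smooth_is_derive z s Hz).
unfold move_x, move_z.
split; auto_derive; try (repeat split; eexists; eassumption);
  change (Derive (fun u => x u)) with (Derive x);
  change (Derive (fun u => z u)) with (Derive z);
  rewrite Ex, Ez; ring.
Qed.

Lemma in_position_exists (D : R -> Prop) (P P1 P2 P3 f g : R -> R) (L : R)
    (x z theta : R -> R) :
  admissible_lagrangian D P P1 P2 P3 -> 0 < L ->
  arc_length_curve L x z theta -> nonconstant_curvature L theta ->
  (forall s, 0 <= s <= L -> D (Derive theta s)) ->
  (forall s, 0 <= s <= L -> euler_lagrange P P1 P2 P3 theta s = 0) ->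
  (forall s, 0 <= s <= L -> f s = P1 (Derive theta s)) ->
  (forall s, 0 <= s <= L ->
     g s = Derive theta s * P1 (Derive theta s) - P (Derive theta s)) ->
  exists d phi c1 c2, 0 < d /\
    in_position L d f g (move_x phi c1 x z) (move_z phi c2 x z).
Proof.
intros HP HL Harc Hnc HD HE Ef Eg.
assert (Ht : smooth theta) by apply Harc.
set (u := force_x P P1 P2 theta 0). set (v := force_z P P1 P2 theta 0).
assert (Hu : forall s, 0 <= s <= L -> force_x P P1 P2 theta s = u).
{ apply is_derive_zero_const. intros s Hs.
  destruct (is_derive_force D P P1 P2 P3 theta s HP Ht (HD s Hs)) as [H _].
  rewrite HE, Rmult_0_r in H by exact Hs. exact H. }
assert (Hv : forall s, 0 <= s <= L -> force_z P P1 P2 theta s = v).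
{ apply is_derive_zero_const. intros s Hs.
  destruct (is_derive_force D P P1 P2 P3 theta s HP Ht (HD s Hs)) as [_ H].
  rewrite HE, Rmult_0_r in H by exact Hs. exact H. }
(* [J = (u, v)] is now constant; [Hg] is its tangential component and [Hk] its normal one. *)
assert (Hg : forall s, 0 <= s <= L ->
  g s = u * cos (theta s) + v * sin (theta s)).
{ intros s Hs. rewrite Eg, <- (Hu s), <- (Hv s) by exact Hs.
  unfold force_x, force_z.
  pose proof (sin2_cos2 (theta s)) as T. unfold Rsqr in T.
  transitivity ((Derive theta s * P1 (Derive theta s) - P (Derive theta s))
    * (sin (theta s) * sin (theta s) + cos (theta s) * cos (theta s)));
    [rewrite T|]; ring. }
assert (Hk : forall s, 0 <= s <= L -> P2 (Derive theta s) * Derive_n theta 2 s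
  = v * cos (theta s) - u * sin (theta s)).
{ intros s Hs. rewrite <- (Hu s), <- (Hv s) by exact Hs.
  unfold force_x, force_z.
  pose proof (sin2_cos2 (theta s)) as T. unfold Rsqr in T.
  transitivity (P2 (Derive theta s) * Derive_n theta 2 s
    * (sin (theta s) * sin (theta s) + cos (theta s) * cos (theta s)));
    [rewrite T|]; ring. }
assert (Huv : 0 < u ^ 2 + v ^ 2).
{ pose proof (pow2_ge_0 u). pose proof (pow2_ge_0 v).
  apply Rnot_le_lt. intros Hle.
  assert (Z : u = 0 /\ v = 0) by (split; nra). destruct Z as [Zu Zv].
  destruct Hnc as (s1 & s2 & H1 & H2 & Hne). apply Hne.
  assert (Hconst : forall s, 0 <= s <= L -> Derive theta s = Derive theta 0).
  { apply is_derive_zero_const. intros s Hs.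
    replace 0 with (Derive_n theta 2 s); [apply smooth_is_derive, smooth_Derive, Ht|].
    specialize (Hk s Hs). rewrite Zu, Zv in Hk.
    destruct HP as [_ HP]. destruct (HP _ (HD s Hs)) as (_ & _ & _ & _ & H2nz).
    apply Rmult_eq_reg_l with (2 := H2nz). rewrite Hk. ring. }
  now rewrite (Hconst s1), (Hconst s2). }
(* With [J = r (sin phi, cos phi)], the rotation by [phi] sends [J] to [(0, r)]. *)
destruct (angle_exists u v Huv) as (phi & Eu & Ev).
assert (Hr : 0 < sqrt (u ^ 2 + v ^ 2)) by now apply sqrt_lt_R0.
set (r := sqrt (u ^ 2 + v ^ 2)) in *.
assert (Hg' : forall s, 0 <= s <= L -> sin (theta s + phi) = / r * g s).
{ intros s Hs. rewrite Hg, Eu, Ev, sin_plus by exact Hs. field. lra. }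
assert (Hk' : forall s, 0 <= s <= L -> cos (theta s + phi)
  = / r * (P2 (Derive theta s) * Derive_n theta 2 s)).
{ intros s Hs. rewrite Hk, Eu, Ev, cos_plus by exact Hs. field. lra. }
(* The horizontal translation enforces [x = d P'(kappa)] at [s = 0], hence everywhere as the
   derivatives agree. The vertical one is free, since the constant of integration absorbs it. *)
exists (/ r), phi, (/ r * P1 (Derive theta 0) - move_x phi 0 x z 0), 0.
split; [now apply Rinv_0_lt_compat|]. split.
- assert (Hc : forall s, 0 <= s <= L ->
    move_x phi 0 x z s - / r * P1 (Derive theta s)
    = move_x phi 0 x z 0 - / r * P1 (Derive theta 0)).
  { apply (is_derive_zero_const (fun s => move_x phi 0 x z s - / r * P1 (Derive theta s))).
    intros s Hs.
    destruct (is_derive_move L x z theta phi 0 0 s Harc Hs) as [HX _].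
    destruct HP as [_ HP]. destruct (HP _ (HD s Hs)) as (_ & H1 & _).
    assert (HK : is_derive (Derive theta) s (Derive_n theta 2 s))
      by apply smooth_is_derive, smooth_Derive, Ht.
    evar_last.
    - apply (is_derive_minus (K := R_AbsRing) (V := R_NormedModule)); [exact HX|].
      apply is_derive_scal.
      apply (is_derive_comp (K := R_AbsRing) (V := R_NormedModule) P1
        (Derive theta)); [exact H1|exact HK].
    - rewrite Hk' by exact Hs. unfold minus, plus, opp, scal, mult.
      cbn -[Derive_n]. ring. }
  intros s Hs. specialize (Hc s Hs). rewrite Ef by exact Hs.
  unfold move_x in *. lra.
- exists (r * move_z phi 0 x z 0). intros s Hs.
  assert (HI : RInt g 0 s = r * (move_z phi 0 x z s - move_z phi 0 x z 0)).
  { apply (is_RInt_unique (V := R_CompleteNormedModule)).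
    apply is_RInt_ext with (fun s => r * sin (theta s + phi)).
    - intros t Ht'. rewrite Rmin_left, Rmax_right in Ht' by lra.
      rewrite Hg', <- Rmult_assoc, Rinv_r by lra. apply Rmult_1_l.
    - apply (is_RInt_scal (V := R_NormedModule)).
      apply (is_RInt_derive (V := R_CompleteNormedModule));
        rewrite Rmin_left, Rmax_right by lra; intros t Ht'.
      + apply (is_derive_move L x z theta phi 0 0 t Harc). lra.
      + apply continuous_sin_comp, (continuous_plus (V := R_NormedModule));
          [now apply smooth_continuous|apply continuous_const]. }
  rewrite HI. field. lra.
Qed.

(** Differentiating the height [d (RInt g 0 s + c)] gives the sine of the rotated angle. Criticality
    is not invoked, so this covers every motion that puts the curve in position. *)
Lemma in_position_sin (f g : R -> R) (L d phi c1 c2 : R) (x z theta : R -> R) :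
  0 < L -> arc_length_curve L x z theta ->
  (forall s, 0 <= s <= L -> continuous g s) ->
  in_position L d f g (move_x phi c1 x z) (move_z phi c2 x z) ->
  forall s, 0 <= s <= L -> sin (theta s + phi) = d * g s.
Proof.
intros HL Harc Cg [_ [c Hpos]].
apply continuous_eq_closed; [exact HL| | |].
- intros s _. apply continuous_sin_comp, (continuous_plus (V := R_NormedModule));
    [apply smooth_continuous, Harc|apply continuous_const].
- intros s Hs. apply (continuous_mult (K := R_AbsRing));
    [apply continuous_const|now apply Cg].
- intros s Hs.
  assert (Hloc : locally s (fun u => 0 < u < L)).
  { apply filter_and; [apply (open_gt 0)|apply (open_lt L)]; lra. }
  destruct (is_derive_move L x z theta phi c1 c2 s Harc) as [_ Hz]; [lra|].
  rewrite <- (is_derive_unique _ _ _ Hz). apply is_derive_unique.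
  apply is_derive_ext_loc with (fun s => d * (RInt g 0 s + c)).
  { apply filter_imp with (2 := Hloc). intros u Hu. symmetry. apply Hpos. lra. }
  apply (is_derive_scal (fun s => RInt g 0 s + c)).
  evar_last.
  + apply (is_derive_plus (K := R_AbsRing) (V := R_NormedModule)).
    * apply (is_derive_RInt (V := R_NormedModule) g) with 0; [|apply Cg; lra].
      apply filter_imp with (2 := Hloc). intros u Hu.
      apply (RInt_correct (V := R_CompleteNormedModule)), @ex_RInt_continuous.
      rewrite Rmin_left, Rmax_right by lra. intros t Ht. apply Cg. lra.
    * apply is_derive_const.
  + apply (plus_zero_r (G := R_AbelianMonoid)).
Qed.

(** In position, [kappa2 = (d g) / (d f) = g / f]: the scale cancels, and the Weingarten relation
    becomes the algebraic identity assumed between [theta'] and [g / f]. *)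
Lemma in_position_weingarten (f g : R -> R) (L d phi c1 c2 a b : R)
    (x z theta : R -> R) :
  0 < L -> 0 < d -> arc_length_curve L x z theta ->
  (forall s, 0 <= s <= L -> continuous g s /\ f s <> 0 /\
     Derive theta s = a * (g s / f s) + b) ->
  in_position L d f g (move_x phi c1 x z) (move_z phi c2 x z) ->
  weingarten L a b (move_x phi c1 x z) (move_angle phi theta).
Proof.
intros HL Hd Harc H Hpos s Hs.
assert (Hsin := in_position_sin f g L d phi c1 c2 x z theta HL Harc
  (fun s Hs => proj1 (H s Hs)) Hpos s Hs).
destruct Hpos as [Hx _]. destruct (H s Hs) as (_ & Hf & E).
unfold kappa1, kappa2. rewrite Hx by exact Hs.
assert (Hdf : d * f s <> 0) by (apply Rmult_integral_contrapositive; lra).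
split; [exact Hdf|].
replace (Derive (move_angle phi theta) s) with (Derive theta s).
- rewrite E. unfold move_angle. rewrite Hsin. field. lra.
- symmetry. unfold move_angle. apply is_derive_unique.
  evar_last.
  + apply (is_derive_plus (K := R_AbsRing) (V := R_NormedModule)).
    * apply smooth_is_derive, Harc.
    * apply is_derive_const.
  + apply (plus_zero_r (G := R_AbelianMonoid)).
Qed.

Lemma critical_position_and_weingarten
    (Space : (R -> R) -> (R -> R) -> Prop) (D : R -> Prop)
    (P P1 P2 P3 f g : R -> R) (L a b : R) (p0 p1 : R * R) (x z theta : R -> R) :
  admissible_lagrangian D P P1 P2 P3 -> 0 < L ->
  arc_length_curve L x z theta -> nonconstant_curvature L theta ->
  (forall X Z, Space X Z <-> Omega L p0 p1 X Z /\ regular_in D L X Z) ->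
  (forall s, D (Derive theta s) ->
     f s = P1 (Derive theta s) /\
     g s = Derive theta s * P1 (Derive theta s) - P (Derive theta s) /\
     continuous g s /\ f s <> 0 /\ Derive theta s = a * (g s / f s) + b) ->
  critical Space (curvature_functional P L) L x z ->
  position_and_weingarten L a b f g x z theta.
Proof.
intros HP HL Harc Hnc HS Hfg Hcr.
assert (Hreg : regular_in D L x z) by apply HS, Hcr.
assert (HD : forall s, 0 <= s <= L -> D (Derive theta s)).
{ intros s Hs.
  rewrite <- (curvature_arc_length_closed _ _ _ _ s HL Harc Hs). now apply Hreg. }
split.
- apply in_position_exists with D P P1 P2 P3 theta; auto;
    try (intros s Hs; now apply (Hfg s), HD).
  apply (euler_lagrange_zero D P P1 P2 P3 L x z); auto.
  apply (critical_critical_along Space D P P1 P2 P3 L p0 p1); auto.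
- intros d phi c1 c2 Hd Hpos.
  apply (in_position_weingarten f g L d phi c1 c2 a b x z); auto.
  intros s Hs. destruct (Hfg s (HD s Hs)) as (_ & _ & H). exact H.
Qed.

(** * The power and exponential Lagrangians *)

Lemma is_derive_Rpower_shift (p mu k : R) : mu < k ->
  is_derive (fun k => Rpower (k - mu) p) k (p * Rpower (k - mu) (p - 1)).
Proof.
intros Hk. evar_last.
- apply (is_derive_comp (K := R_AbsRing) (V := R_NormedModule)
    (fun y => Rpower y p) (fun k => k - mu)).
  + apply is_derive_Reals, derivable_pt_lim_power. lra.
  + instantiate (1 := 1). auto_derive; auto.
- unfold scal; simpl; unfold mult; simpl. ring.
Qed.

Lemma Rpower_succ (y q : R) : 0 < y -> Rpower y q = y * Rpower y (q - 1).
Proof.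
intros Hy. rewrite <- (Rpower_1 y Hy) at 2. rewrite <- Rpower_plus. f_equal. ring.
Qed.

(** Since [Rpower] is an exponential and hence positive, [p <> 0] and [p <> 1] are what keeps the
    second derivative away from zero. *)
Lemma admissible_power (p mu : R) : p <> 0 -> p <> 1 ->
  admissible_lagrangian (fun k => mu < k) (fun k => Rpower (k - mu) p)
    (fun k => p * Rpower (k - mu) (p - 1))
    (fun k => p * ((p - 1) * Rpower (k - mu) (p - 1 - 1)))
    (fun k => p * ((p - 1) * ((p - 1 - 1) * Rpower (k - mu) (p - 1 - 1 - 1)))).
Proof.
intros H0 H1. split; [apply open_gt|]. intros k Hk.
split; [now apply is_derive_Rpower_shift|].
split; [now apply is_derive_scal, is_derive_Rpower_shift|].
split; [now apply is_derive_scal, is_derive_scal, is_derive_Rpower_shift|].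
split.
- repeat (apply (continuous_mult (K := R_AbsRing)); [apply continuous_const|]).
  eapply is_derive_continuous, is_derive_Rpower_shift, Hk.
- pose proof (exp_pos ((p - 1 - 1) * ln (k - mu))) as He.
  repeat apply Rmult_integral_contrapositive_currified; unfold Rpower; lra.
Qed.

Lemma is_derive_exp_scal (c nu k : R) :
  is_derive (fun k => c * exp (nu * k)) k (nu * c * exp (nu * k)).
Proof. auto_derive; auto. ring. Qed.

Lemma admissible_exp (nu : R) : nu <> 0 ->
  admissible_lagrangian (fun _ => True) (fun k => exp (nu * k))
    (fun k => nu * exp (nu * k)) (fun k => nu * nu * exp (nu * k))
    (fun k => nu * (nu * nu) * exp (nu * k)).
Proof.
intros H0. split; [apply open_true|]. intros k _.
split; [auto_derive; auto; ring|].
split; [apply is_derive_exp_scal|]. split; [apply is_derive_exp_scal|]. split.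
- eapply is_derive_continuous, is_derive_exp_scal.
- pose proof (exp_pos (nu * k)).
  repeat apply Rmult_integral_contrapositive_currified; lra.
Qed.

Theorem proposition2p2 (L : R) (p0 p1 : R * R) (x z theta : R -> R) :
  0 < L ->
  arc_length_curve L x z theta ->
  nonconstant_curvature L theta ->
  (forall p mu : R, p <> 0 -> p <> 1 ->
     critical (Omega_star mu L p0 p1) (F_star p mu L) L x z ->
     position_and_weingarten L (p / (p - 1)) (- mu / (p - 1))
       (fun s => p * Rpower (Derive theta s - mu) (p - 1))
       (fun s => Rpower (Derive theta s - mu) (p - 1)
                 * ((p - 1) * Derive theta s + mu))
       x z theta)
  /\
  (forall nu : R, nu <> 0 ->
     critical (Omega L p0 p1) (F_exp nu L) L x z ->
     position_and_weingarten L 1 (1 / nu)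
       (fun s => nu * exp (nu * Derive theta s))
       (fun s => (nu * Derive theta s - 1) * exp (nu * Derive theta s))
       x z theta).
Proof.
intros HL Harc Hnc.
assert (CK : forall s, continuous (Derive theta) s)
  by (intros s; apply smooth_continuous, smooth_Derive, Harc).
split.
- intros p mu Hp0 Hp1 Hcr.
  apply critical_position_and_weingarten with (Space := Omega_star mu L p0 p1)
    (p0 := p0) (p1 := p1) (1 := admissible_power p mu Hp0 Hp1); auto.
  + intros X Z. unfold Omega_star, regular_in. split.
    * intros [HO H]. split; [exact HO|]. intros s Hs.
      split; [apply HO|apply H]; exact Hs.
    * intros [HO H]. split; [exact HO|]. intros s Hs. apply H, Hs.
  + intros s Hs. cbv beta.
    assert (Hpow := exp_pos ((p - 1) * ln (Derive theta s - mu))).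
    change (0 < Rpower (Derive theta s - mu) (p - 1)) in Hpow.
    split; [reflexivity|]. split.
    (* With [y = kappa - mu], [kappa p y^(p-1) - y^p = y^(p-1) (p kappa - y)], and
       [p kappa - y = (p - 1) kappa + mu]. *)
    { rewrite (Rpower_succ _ p) by lra. ring. }
    split.
    { apply (continuous_mult (K := R_AbsRing)).
      - apply (continuous_comp (Derive theta) (fun k => Rpower (k - mu) (p - 1))).
        + apply CK.
        + eapply is_derive_continuous, is_derive_Rpower_shift, Hs.
      - split_continuous. apply CK. }
    split; [apply Rmult_integral_contrapositive_currified; lra|].
    (* Here [g / f = ((p - 1) kappa + mu) / p]; solving for [kappa] gives [a = p / (p - 1)] and
       [b = - mu / (p - 1)]. *)
    field. lra.
- intros nu Hnu Hcr.
  apply critical_position_and_weingarten with (Space := Omega L p0 p1)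
    (p0 := p0) (p1 := p1) (1 := admissible_exp nu Hnu); auto.
  + intros X Z. unfold regular_in. split; [|now intros [HO _]].
    intros HO. split; [exact HO|]. intros s Hs. split; [apply HO, Hs|exact I].
  + intros s _. cbv beta.
    assert (Hpow := exp_pos (nu * Derive theta s)).
    split; [reflexivity|]. split; [ring|]. split.
    { split_continuous; try apply CK.
      apply continuous_exp_comp. split_continuous. apply CK. }
    split; [apply Rmult_integral_contrapositive_currified; lra|].
    (* Here [g / f = (nu kappa - 1) / nu = kappa - 1 / nu]. *)
    field. lra.
Qed.
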